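(* Let $\pi$ and $\pi'$ be two different non-increasing tree degree sequences with $\pi\lhd\pi'$, and let $f$ be a good escalating function. Let $T$ and $T'$ be extremal trees of $\Gamma(\pi)$ and $\Gamma(\pi')$, respectively (i.e., trees maximizing $M_f$ in these classes). Then $M_f(T)<M_f(T')$.
   Context: Graphs are finite, simple, connected; $d(v)$ is the degree. A tree degree sequence is the non-increasing degree sequence of some tree; $\Gamma(\pi)$ is the set of connected graphs with degree sequence $\pi$. For non-increasing sequences $\pi=(x_1,\dots,x_n)$, $\pi'=(x'_1,\dots,x'_n)$ of reals, $\pi\lhd\pi'$ means $\pi\ne\pi'$, $\sum_{i=1}^n x_i=\sum_{i=1}^n x'_i$ and $\sum_{i=1}^j x_i\le\sum_{i=1}^j x'_i$ for all $j$. For a symmetric function $f(x,y)$ on pairs of positive reals, $M_f(G)=\sum_{uv\in E(G)}f(d(u),d(v))$. $f$ is escalating if $f(x_1,x_2)+f(y_1,y_2)\ge f(x_2,y_1)+f(x_1,y_2)$ for all $x_1\ge y_1>0$, $x_2\ge y_2>0$, strictly whenever $x_1>y_1$ and $x_2>y_2$. An escalating $f$ is good escalating if $\frac{\partial f}{\partial x}>0$, $\frac{\partial^2 f}{\partial x^2}\ge 0$, and $f(x_1+1,x_2)+f(x_1+1,y_1-1)\ge f(x_2,y_1)+f(x_1,y_1)$ for all $x_1\ge y_1$ and $x_2\ge 1$. *)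

(* Defs.v *)
From HB Require Import structures.
From mathcomp Require Import all_boot all_order all_algebra.
From mathcomp Require Import boolp classical_sets reals topology normedtype derive.

Set Implicit Arguments.
Unset Strict Implicit.
Unset Printing Implicit Defensive.

Import Order.TTheory GRing.Theory Num.Theory.
Import numFieldNormedType.Exports.

Local Open Scope ring_scope.

Record sgraph := SGraph {
  vertex :> finType;
  adj : rel vertex;
  adj_sym : symmetric adj;
  adj_irr : irreflexive adj
}.

Definition deg (G : sgraph) (v : G) : nat := #|[pred w | adj v w]|.

Definition degree_seq (G : sgraph) : seq nat :=
  sort geq [seq deg v | v <- enum G].

Definition connected_graph (G : sgraph) : Prop :=
  (0 < #|G|)%N /\ forall u v : G, connect (@adj G) u v.

(* Any edge uv yields the closed walk [:: u; v], so only repetition-free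
   cyclic sequences with at least three vertices are graph cycles. *)
Definition acyclic_graph (G : sgraph) : Prop :=
  forall c : seq G, ucycle (@adj G) c -> (size c < 3)%N.

Definition is_tree (G : sgraph) : Prop := connected_graph G /\ acyclic_graph G.

(* [degree_seq] is sorted, so such a sequence is automatically non-increasing. *)
Definition tree_degree_seq (pi : seq nat) : Prop :=
  exists2 G : sgraph, is_tree G & degree_seq G = pi.

Definition Gamma (pi : seq nat) (G : sgraph) : Prop :=
  connected_graph G /\ degree_seq G = pi.

Definition majorized (pi pi' : seq nat) : Prop :=
  [/\ pi <> pi',
      size pi = size pi',
      (\sum_(i < size pi) nth 0 pi i = \sum_(i < size pi) nth 0 pi' i)%N &
      forall j : nat, (j <= size pi)%N ->
        (\sum_(i < j) nth 0 pi i <= \sum_(i < j) nth 0 pi' i)%N].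

Section Functions.
Variable R : realType.

(* A function on pairs of positive reals is a total [f : R -> R -> R] of which
   only the values at positive arguments are ever constrained. *)
Implicit Type f : R -> R -> R.

Definition symmetric_pos f : Prop :=
  forall x y : R, 0 < x -> 0 < y -> f x y = f y x.

Definition escalating f : Prop :=
  forall x1 x2 y1 y2 : R, 0 < y1 -> y1 <= x1 -> 0 < y2 -> y2 <= x2 ->
    f x2 y1 + f x1 y2 <= f x1 x2 + f y1 y2 /\
    (y1 < x1 -> y2 < x2 -> f x2 y1 + f x1 y2 < f x1 x2 + f y1 y2).

(* [1 < y1] is what places [y1 - 1] in the domain of [f]. *)
Definition good_escalating f : Prop :=
  [/\ escalating f,
      forall x y : R, 0 < x -> 0 < y ->
        derivable (fun t => f t y) x 1 /\ 0 < derive1 (fun t => f t y) x,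
      forall x y : R, 0 < x -> 0 < y ->
        derivable (derive1 (fun t => f t y)) x 1 /\
        0 <= derive1 (derive1 (fun t => f t y)) x &
      forall x1 x2 y1 : R, 1 < y1 -> y1 <= x1 -> 1 <= x2 ->
        f x2 y1 + f x1 y1 <= f (x1 + 1) x2 + f (x1 + 1) (y1 - 1)].

(* Each edge is counted once, through its endpoints listed in increasing
   [enum_rank]; the choice is immaterial for symmetric [f]. *)
Definition Mf f (G : sgraph) : R :=
  \sum_(p : G * G | adj p.1 p.2 && (enum_rank p.1 < enum_rank p.2)%N)
    f (deg p.1)%:R (deg p.2)%:R.

Definition extremal_tree f (pi : seq nat) (T : sgraph) : Prop :=
  [/\ is_tree T, Gamma pi T &
      forall G : sgraph, Gamma pi G -> Mf f G <= Mf f T].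

End Functions.

(* Main.v *)
(* A dominance pi <| pi' is a chain of unit transfers: one unit of degree passes
   from a smaller entry to a larger one, and the sequence stays sorted. So it is
   enough to raise the weight of a tree T that is maximal for its degrees when
   d(u) >= d(v) >= 2 become d(u) + 1 and d(v) - 1. This is done by moving a
   branch w of v (a neighbour off the u-v path) over to u. With
   D_t(s) = f(t + 1, s) - f(t, s), which is positive and nondecreasing in t (by
   convexity) and in s (by escalation), the gain is
     sum_{y in N(u) - v} D_{d(u)}(d(y)) - sum_{y in N(v) - u, y <> w} D_{d(v)-1}(d(y))
   plus f(d(u)+1, d(w)) - f(d(v), d(w)), to which, if u and v are adjacent,
   f(d(u)+1, d(v)-1) - f(d(u), d(v)) is added; this last part is nonnegative.
   If d(u) = d(v), the difference of sums is positive for one of the two choices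
   of which vertex plays u. If d(u) > d(v), maximality under the exchange
   {ua, vb} -> {ub, va} shows that each branch of u has degree at least that of
   each branch of v, and likewise for the neighbours of u and v on the path; the
   two sums are then compared by counting terms. *)
Require Import Defs.
From HB Require Import structures.
From mathcomp Require Import all_boot all_order all_algebra.
From mathcomp Require Import boolp classical_sets reals topology normedtype derive.
From mathcomp Require Import perm zify ring lra.

Set Implicit Arguments.
Unset Strict Implicit.
Unset Printing Implicit Defensive.

Import Order.TTheory GRing.Theory Num.Theory.
Import numFieldNormedType.Exports.

(** * Edge exchanges in trees *)

Section EdgeOperations.
Variable V : finType.
Implicit Types (e h : rel V) (a b u v w x y : V).

Definition edge_pred a b s t :=
  ((s == a) && (t == b)) || ((s == b) && (t == a)).
Definition del_edge e a b s t := e s t && ~~ edge_pred a b s t.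
Definition add_edge e a b s t := e s t || edge_pred a b s t.

Lemma edge_pred_sym a b : symmetric (edge_pred a b).
Proof. by move=> s t; rewrite /edge_pred orbC (andbC (s == a)) (andbC (s == b)). Qed.

Lemma edge_predC a b s t : edge_pred a b s t = edge_pred b a s t.
Proof. by rewrite /edge_pred orbC. Qed.

Lemma edge_predP a b s t :
  reflect ((s = a /\ t = b) \/ (s = b /\ t = a)) (edge_pred a b s t).
Proof.
apply: (iffP orP) => -[].
- by case/andP=> /eqP-> /eqP->; left.
- by case/andP=> /eqP-> /eqP->; right.
- by case=> -> ->; left; rewrite !eqxx.
- by case=> -> ->; right; rewrite !eqxx.
Qed.

Lemma del_edge_sym e a b : symmetric e -> symmetric (del_edge e a b).
Proof. by move=> es s t; rewrite /del_edge es (edge_pred_sym a b s t). Qed.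

Lemma add_edge_sym e a b : symmetric e -> symmetric (add_edge e a b).
Proof. by move=> es s t; rewrite /add_edge es (edge_pred_sym a b s t). Qed.

Lemma del_edge_irr e a b : irreflexive e -> irreflexive (del_edge e a b).
Proof. by move=> ei s; rewrite /del_edge /= ei. Qed.

Lemma add_edge_irr e a b : a != b -> irreflexive e -> irreflexive (add_edge e a b).
Proof.
move=> nab ei s; rewrite /add_edge /edge_pred ei /= (andbC (s == b)) orbb.
by apply: contraNF nab => /andP[/eqP<- /eqP<-].
Qed.

Lemma del_edge_sub e a b : subrel (del_edge e a b) e.
Proof. by move=> s t /andP[]. Qed.

Lemma connect_subrel e h : subrel e h -> subrel (connect e) (connect h).
Proof. by move=> eh; apply: connect_sub => s t st; apply/connect1/eh. Qed.

(** By induction along the walk: two crossings of the new edge in opposite directions cancel, so at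
    most one has to be recorded. *)
Lemma connect_add_edge h u w x y : connect (add_edge h u w) x y ->
  [\/ connect h x y, connect h x u /\ connect h w y
    | connect h x w /\ connect h u y].
Proof.
case/connectP=> p; elim: p x => [|z p IH] x /=.
  by move=> _ ->; apply: Or31; apply: connect0.
case/andP=> xz pp yl; have {}IH := IH z pp yl.
case/orP: xz => [xz|/edge_predP[[-> zw]|[-> zw]]].
- have xz' := connect1 xz.
  case: IH => [c|[c d]|[c d]]; [apply: Or31|apply: Or32|apply: Or33];
  by rewrite ?(connect_trans xz').
- subst z; case: IH => [c|[c d]|[c d]].
  + by apply: Or32; split.
  + by apply: Or32; split.
  + by apply: Or31.
- subst z; case: IH => [c|[c d]|[c d]].
  + by apply: Or33; split.
  + by apply: Or31.
  + by apply: Or33; split.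
Qed.

End EdgeOperations.

(** * Trees as connected relations in which every edge is a bridge *)

Section Trees.
Variable V : finType.
Implicit Types (e h : rel V) (a b u v w x y : V).

(** Acyclicity in a form that can be followed through an edge exchange by connectivity alone, with
    no cycle to manipulate. *)
Definition bridged e := forall x y, e x y -> ~~ connect (del_edge e x y) x y.

Record tree_rel e : Prop := TreeRel {
  tree_sym : symmetric e;
  tree_irr : irreflexive e;
  tree_conn : forall x y, connect e x y;
  tree_bridged : bridged e }.

Lemma sym_connect e x y : symmetric e -> connect e x y -> connect e y x.
Proof. by move=> es; rewrite (sym_connect_sym es). Qed.

Lemma move_edge_conn e u v w : symmetric e -> (forall x y, connect e x y) ->
  connect (del_edge e v w) u v ->
  forall x y, connect (add_edge (del_edge e v w) u w) x y.
Proof.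
move=> es ec uv x y.
set h := add_edge _ _ _.
have hs : symmetric h by apply/add_edge_sym/del_edge_sym.
have vw : connect h v w.
  have uw : h u w by rewrite /h /add_edge /edge_pred !eqxx !orbT.
  apply: connect_trans (connect1 uw); apply: sym_connect => //.
  by apply: connect_subrel uv => s t st; rewrite /h /add_edge st.
apply: (@connect_sub _ e) (ec x y) => s t st.
have [/edge_predP[[-> ->]|[-> ->]]|n] := boolP (edge_pred v w s t) => //.
  exact: sym_connect.
by apply: connect1; rewrite /h /add_edge /del_edge st n.
Qed.

(** Without [v w] there are two components, [u] and [v] in one and [w] in the other, and [u w] joins
    the same two. A cycle through another edge [x y] would have to use [u w], and its remainder
    would link [u] to [w] without [v w]. *)
Lemma move_edge_bridged e u v w : symmetric e -> bridged e -> e v w ->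
  connect (del_edge e v w) u v -> bridged (add_edge (del_edge e v w) u w).
Proof.
move=> es eb vw uv x y exy; apply/negP => cxy.
have nvw := negP (eb _ _ vw).
have ds : symmetric (del_edge e v w) by apply: del_edge_sym.
have vu := sym_connect ds uv.
case/boolP: (edge_pred u w x y) => [xyuw|nxy].
  have sub : subrel (del_edge (add_edge (del_edge e v w) u w) x y) (del_edge e v w).
    move=> s t /andP[/orP[//|stuw]].
    by case/edge_predP: xyuw => [[-> ->]|[-> ->]]; rewrite 1?(edge_predC w u) stuw.
  have := connect_subrel sub cxy.
  case/edge_predP: xyuw => [[-> ->]|[-> ->]] c; apply: nvw.
    exact: connect_trans vu c.
  exact: connect_trans vu (sym_connect ds c).
have dxy : del_edge e v w x y.
  by case/orP: exy => // k; rewrite k in nxy.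
have exy' := del_edge_sub dxy.
set h := del_edge (del_edge e v w) x y.
have sub : subrel (del_edge (add_edge (del_edge e v w) u w) x y) (add_edge h u w).
  move=> s t /andP[] => /orP[k|k] n; apply/orP; [left|right] => //.
  by apply/andP.
have hd : subrel (connect h) (connect (del_edge e v w)).
  by apply: connect_subrel => s t /andP[].
case: (connect_add_edge (connect_subrel sub cxy)) => [c|[c d]|[c d]].
- have := eb _ _ exy'; rewrite (connect_subrel _ c) // => s t /andP[/andP[k _] n].
  by apply/andP.
- apply: nvw; apply: connect_trans vu _; apply: connect_trans (sym_connect ds (hd _ _ c)) _.
  by apply: connect_trans (connect1 dxy) _; apply: sym_connect (hd _ _ d).
- apply: nvw; apply: connect_trans vu _; apply: connect_trans (hd _ _ d) _.
  rewrite (sym_connect_sym ds).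
  by apply: connect_trans (sym_connect ds (hd _ _ c)) (connect1 dxy).
Qed.

Definition switch_edges e u x v y :=
  add_edge (add_edge (del_edge (del_edge e u x) v y) u y) v x.

Lemma switch_edges_conn e u x v y : symmetric e -> (forall s t, connect e s t) ->
  connect (del_edge (del_edge e u x) v y) u v \/
  connect (del_edge (del_edge e u x) v y) x y ->
  forall s t, connect (switch_edges e u x v y) s t.
Proof.
move=> es ec cc s t; set h := switch_edges _ _ _ _ _.
have hs : symmetric h by do 2!apply: add_edge_sym; do 2!apply: del_edge_sym.
have sub : subrel (del_edge (del_edge e u x) v y) h.
  by move=> a b ab; apply/orP; left; apply/orP; left.
have huy : connect h u y.
  by apply: connect1; rewrite /h /switch_edges /add_edge /edge_pred !eqxx !orbT.
have hvx : connect h v x.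
  by apply: connect1; rewrite /h /switch_edges /add_edge /edge_pred !eqxx !orbT.
have huv : connect h u v.
  case: cc => c; have {}c := connect_subrel sub c => //.
  apply: connect_trans huy _; apply: connect_trans (sym_connect hs c) _.
  exact: sym_connect.
have hux := connect_trans huv hvx.
have hvy := connect_trans (sym_connect hs huv) huy.
apply: (@connect_sub _ e) (ec s t) => a b ab.
have [/edge_predP[[-> ->]|[-> ->]]|n1] := boolP (edge_pred u x a b) => //.
  exact: sym_connect.
have [/edge_predP[[-> ->]|[-> ->]]|n2] := boolP (edge_pred v y a b) => //.
  exact: sym_connect.
by apply/connect1/sub; apply/andP; split => //; apply/andP.
Qed.

(** The switch is two successive moves: [x] passes from [u] to [v], then [y] from [v] to [u]. *)
Lemma switch_edges_bridged e u x v y : symmetric e -> bridged e ->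
  u != v -> v != x -> x != y -> e u x -> e v y ->
  connect (del_edge (del_edge e u x) v y) u v ->
  bridged (switch_edges e u x v y).
Proof.
move=> es eb nuv nvx nxy ux vy cuv.
have -> : switch_edges e u x v y =
    add_edge (del_edge (add_edge (del_edge e u x) v x) v y) u y.
  apply/funext => s; apply/funext => t.
  (* Deleting [v y] commutes with adding [v x] because these edges are different. *)
  have : edge_pred v x s t -> ~~ edge_pred v y s t.
    move=> /edge_predP H1; apply: contra nxy => /edge_predP H2.
    by case: H1 H2 => -[-> ->] [] [? ?]; subst.
  rewrite /switch_edges /add_edge /del_edge.
  by case: (e s t); do !case: (edge_pred _ _ _ _) => //; move=> /(_ isT).
have s1 : symmetric (del_edge e u x) by apply: del_edge_sym.
have sub : subrel (del_edge (del_edge e u x) v y) (del_edge e u x).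
  exact: del_edge_sub.
apply: move_edge_bridged.
- exact: add_edge_sym.
- apply: move_edge_bridged => //; apply: sym_connect => //.
  exact: (connect_subrel sub).
- rewrite /add_edge /del_edge vy /edge_pred.
  by rewrite eq_sym (negPf nuv) (negPf nvx).
- apply: connect_subrel cuv => s t /andP[st n].
  by apply/andP; split=> //; apply/orP; left.
Qed.

Lemma switch_edges_tree e u x v y : tree_rel e -> u != v -> u != y -> v != x ->
  x != y -> e u x -> e v y ->
  connect (del_edge (del_edge e u x) v y) u v \/
  connect (del_edge (del_edge e u x) v y) x y ->
  tree_rel (switch_edges e u x v y).
Proof.
move=> [es ei ec eb] nuv nuy nvx nxy ux vy cc; split.
- by do 2!apply: add_edge_sym; do 2!apply: del_edge_sym.
- by do 2!apply: add_edge_irr => //; do 2!apply: del_edge_irr.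
- exact: switch_edges_conn.
case: cc => cc; first exact: switch_edges_bridged.
have flip a b : edge_pred a b = edge_pred b a.
  by apply/funext => s; apply/funext => t; apply: edge_predC.
(* Reading both edges from their other ends turns the second connectivity alternative into the
   first. *)
have -> : switch_edges e u x v y = switch_edges e x u y v.
  apply/funext => s; apply/funext => t.
  rewrite /switch_edges /add_edge /del_edge (flip y u) (flip x v) (flip x u) (flip y v).
  exact: orbAC.
apply: switch_edges_bridged => //; rewrite 1?es 1?eq_sym //.
by apply: connect_subrel cc => s t; rewrite /del_edge (flip x u) (flip y v).
Qed.

(* [p] and [q] are the neighbours of [u] and [v] on the path from [u] to [v];
   the other neighbours carry the branches that can be moved freely. *)
Record path_ends e u v p q : Prop := PathEnds {
  pe_up : e u p;
  pe_vq : e v q;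
  pe_u : forall a, e u a -> a != p -> ~~ e a v /\ a != v;
  pe_v : forall b, e v b -> b != q -> ~~ e b u /\ b != u;
  pe_conn : forall a b, a != p -> b != q ->
    connect (del_edge (del_edge e u a) v b) u v;
  pe_cases : (e u v /\ p = v /\ q = u) \/
    (~~ e u v /\ connect (del_edge (del_edge e u p) v q) p q) }.

Lemma tree_no_bypass e x y h : tree_rel e -> subrel h (del_edge e x y) ->
  e x y -> connect h x y -> False.
Proof.
by move=> et sub xy c; have /negP := tree_bridged et xy; apply; apply: connect_subrel c.
Qed.

(** For non-adjacent vertices [p] and [q] are the second and the last but one vertex of a simple
    path. Every adjacency to be excluded would give a bypass of some edge. *)
Lemma path_ends_exist e u v : tree_rel e -> u != v ->
  exists p q, path_ends e u v p q.
Proof.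
move=> et nuv; have es := tree_sym et.
have irr x y : e x y -> x != y.
  by move=> xy; apply/eqP=> xy'; move: xy; rewrite xy' (tree_irr et).
(* Each disjunct rules out both orientations of the deleted edge. *)
have delI a b s t : e s t -> (s != a) && (s != b) || (t != a) && (t != b) ||
    (s != a) && (t != a) || (s != b) && (t != b) -> connect (del_edge e a b) s t.
  move=> st H; apply/connect1/andP; split=> //; apply/negP => /edge_predP[[sa tb]|[sa tb]];
  by move: H; rewrite sa tb !eqxx /= ?andbF.
case/boolP: (e u v) => [uv|nadj].
  exists v, u; split=> //; first by rewrite es.
  - move=> a ua nav; split=> //; apply/negP => av.
    apply: (tree_no_bypass et (fun s t => id) av).
    apply: (@connect_trans _ _ u); apply: delI => //; rewrite 1?es //.
      by rewrite (irr _ _ ua) nuv ?orbT.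
    by rewrite (irr _ _ ua) nuv ?orbT.
  - move=> b vb nbu; split=> //; apply/negP => bu.
    apply: (tree_no_bypass et (fun s t => id) bu).
    apply: (@connect_trans _ _ v); apply: delI => //; rewrite 1?es //.
      by rewrite (irr _ _ vb) (eq_sym v) nuv ?orbT.
    by rewrite (irr _ _ vb) (eq_sym v) nuv ?orbT.
  - move=> a b nav nbu; apply: connect1; rewrite /del_edge /edge_pred uv /= !eqxx /=.
    by rewrite !(eq_sym v) !(eq_sym u) (negPf nav) (negPf nbu) (eq_sym v) (negPf nuv) /= !andbF.
  - by left.
have [p0 pp0 vl0] := connectP (tree_conn et u v).
case/shortenP: pp0 vl0 => p pp up _ vl {p0}.
case: p pp up vl => [|p1 p]; first by move=> _ _ vu; rewrite vu eqxx in nuv.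
case/lastP: p => [|m z].
  by rewrite /= andbT => up1 _ vp; rewrite vp up1 in nadj.
rewrite [path _ _ _]/= rcons_path => /and3P[up pm qz] uq /=.
rewrite last_rcons => zv; subst z; set q := last p1 m in qz.
(* Edges touching neither [u] nor [v] survive every deletion at [u] or [v], and the interior of the
   path consists of such edges. *)
pose I : rel V := [rel s t | e s t && [&& s != u, s != v, t != u & t != v]].
have avoid x : x \in p1 :: m -> (x != u) && (x != v).
  move=> xm; move: uq; rewrite -rcons_cons cons_uniq rcons_uniq mem_rcons.
  rewrite in_cons negb_or => /andP[/andP[_ um]] /andP[vm _].
  by apply/andP; split; [apply: contraNneq um | apply: contraNneq vm] => <-.
have Ipq : connect I p1 q.
  apply/connectP; exists m => //.
  apply: (sub_in_path (P := mem (p1 :: m))) pm; last by apply/allP.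
  move=> x y xm ym xy; rewrite /I /= xy /=.
  by case/andP: (avoid _ xm) => -> ->; case/andP: (avoid _ ym) => -> ->.
have Is : symmetric I.
  move=> x y; rewrite /I /= es.
  by case: (x != u); case: (y != u); case: (x != v); case: (y != v); rewrite ?andbF.
have [p1u p1v] := andP (avoid _ (mem_head _ _)).
have /andP[qu qv] : (q != u) && (q != v) by apply: avoid; apply: mem_last.
have Idel a x : (x == u) || (x == v) -> subrel I (del_edge e x a).
  move=> xx s t /andP[st /and4P[su sv tu tv]].
  apply/andP; split=> //; apply/negP => /edge_predP[[sx tx]|[sx tx]];
  by case/orP: xx => /eqP xx; subst; rewrite eqxx in su sv tu tv.
have vq : e v q by rewrite es.
have nadj' : ~~ e v u by rewrite es.
(* If another neighbour of [u] were [q], the path interior would bypass the edge from [u] to it. *)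
have Iuq a : a != p1 -> ~~ (e u a && (a == q)).
  move=> nap; apply/negP => /andP[ua /eqP aq]; subst a.
  apply: (tree_no_bypass et (fun s t => id) ua).
  apply: (@connect_trans _ _ p1).
    by apply: delI => //; rewrite p1u (eq_sym p1) nap !orbT.
  by apply: connect_subrel Ipq; apply: Idel => //; rewrite eqxx.
have Ivp b : b != q -> ~~ (e v b && (b == p1)).
  move=> nbq; apply/negP => /andP[vb /eqP bp]; subst b.
  apply: (tree_no_bypass et (fun s t => id) vb).
  apply: (@connect_trans _ _ q).
    by apply: delI => //; rewrite qv (eq_sym q) nbq !orbT.
  by apply: connect_subrel (sym_connect Is Ipq); apply: Idel => //; rewrite eqxx orbT.
exists p1, q; split=> //.
- move=> a ua nap; split; last by apply: contraNneq nadj => <-.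
  apply/negP => av.
  have naq : a != q by have := Iuq _ nap; rewrite ua.
  (* The detour from [v] to [a] runs back along the path through [q] and [p1] to [u], and from there
     to [a]. *)
  rewrite es in av; apply: (tree_no_bypass et (fun s t => id) av).
  apply: (@connect_trans _ _ q); first by apply: delI => //; rewrite qv (eq_sym q) naq !orbT.
  apply: (@connect_trans _ _ p1).
    by apply: connect_subrel (sym_connect Is Ipq); apply: Idel => //; rewrite eqxx orbT.
  apply: (@connect_trans _ _ u).
    by apply: delI; rewrite 1?es // p1v (eq_sym p1) nap.
  by apply: delI => //; rewrite nuv (irr _ _ ua) ?orbT.
- move=> b vb nbq; split; last by apply: contraNneq nadj' => <-.
  apply/negP => bu.
  have nbp : b != p1 by have := Ivp _ nbq; rewrite vb.
  rewrite es in bu; apply: (tree_no_bypass et (fun s t => id) bu).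
  apply: (@connect_trans _ _ p1); first by apply: delI => //; rewrite p1u (eq_sym p1) nbp !orbT.
  apply: (@connect_trans _ _ q).
    by apply: connect_subrel Ipq; apply: Idel => //; rewrite eqxx.
  apply: (@connect_trans _ _ v).
    by apply: delI; rewrite 1?es // qu (eq_sym q) nbq.
  by apply: delI => //; rewrite (eq_sym v) nuv (irr _ _ vb) ?orbT.
- move=> a b nap nbq; apply: (@connect_trans _ _ p1); last apply: (@connect_trans _ _ q).
  + apply: connect1; rewrite /del_edge /edge_pred up /= !eqxx /=.
    rewrite (eq_sym p1) (negPf nap) (negPf nuv) (negPf p1u) (negPf p1v) /=.
    by rewrite !andbF.
  + apply: connect_subrel Ipq => s t /andP[st /and4P[su sv tu tv]].
    by rewrite /del_edge /edge_pred st (negPf su) (negPf sv) (negPf tu) (negPf tv) /= !andbF.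
  + apply: connect1; rewrite /del_edge /edge_pred qz /= !eqxx /=.
    rewrite (eq_sym q b) (negPf nbq) (negPf qu) (negPf qv) (eq_sym v u) (negPf nuv) /=.
    by rewrite !andbF.
- right; split=> //.
  apply: connect_subrel Ipq => s t /andP[st /and4P[su sv tu tv]].
  by rewrite /del_edge /edge_pred st (negPf su) (negPf sv) (negPf tu) (negPf tv) /= !andbF.
Qed.

End Trees.

(** A simple bypass of [x y], closed by [x y], is a cycle. It has at least three vertices, since a
    bypass of one edge would be the deleted edge itself. *)
Lemma acyclic_bridged (G : sgraph) : acyclic_graph G -> bridged (@adj G).
Proof.
move=> ac x y xy; apply/negP => /connectP[p0 pp0 yl0].
case/shortenP: pp0 yl0 => p pp up _ yl.
have := ac (x :: p); rewrite /ucycle up andbT /= rcons_path -yl.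
have -> : path (@adj G) x p by apply: sub_path pp; apply: del_edge_sub.
rewrite adj_sym xy => /(_ isT).
case: p pp up yl => [|z [|t p]] //=.
  by move=> _ _ yx; move: xy; rewrite yx adj_irr.
by move=> + _ yz; rewrite /del_edge /edge_pred -yz !eqxx /= andbF.
Qed.

(** * Majorization by unit transfers *)

Definition psum (s : seq nat) j := \sum_(i < j) nth 0 s i.

Lemma psumS s j : psum s j.+1 = psum s j + nth 0 s j.
Proof. by rewrite /psum big_ord_recr. Qed.

Lemma psum0 s : psum s 0 = 0.
Proof. by rewrite /psum big_ord0. Qed.

Lemma geq_sorted_nth (s : seq nat) : sorted geq s <->
  (forall i, nth 0 s i.+1 <= nth 0 s i).
Proof.
split=> [ss i|H].
  have [lt_i|ge_i] := ltnP i.+1 (size s); last by rewrite nth_default.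
  by have := sortedP 0 ss; apply.
by apply/(sortedP 0) => i _; apply: H.
Qed.

Definition unit_transfer (s : seq nat) p q :=
  mkseq (fun i => nth 0 s i + (i == p) - (i == q)) (size s).

Lemma size_unit_transfer s p q : size (unit_transfer s p q) = size s.
Proof. exact: size_mkseq. Qed.

Lemma nth_unit_transfer s p q i : p < size s -> q < size s ->
  nth 0 (unit_transfer s p q) i = nth 0 s i + (i == p) - (i == q).
Proof.
move=> ps qs; have [lt_i|ge_i] := ltnP i (size s); first by rewrite nth_mkseq.
rewrite !nth_default ?size_unit_transfer //.
by rewrite !gtn_eqF // (leq_trans _ ge_i).
Qed.

Lemma psum_unit_transfer s p q j : p < q -> q < size s -> 0 < nth 0 s q ->
  psum (unit_transfer s p q) j = psum s j + (p < j <= q).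
Proof.
move=> pq qs sq; have ps := ltn_trans pq qs.
elim: j => [|j IH]; first by rewrite !psum0.
rewrite !psumS IH nth_unit_transfer //.
case: (eqVneq j q) => [->|jq]; case: (eqVneq j p) => [jp|jp]; lia.
Qed.

(** Take for [p] the first index where the sequences differ and for [q.+1] the first later length at
    which the partial sums agree again. In between the sums differ by at least one, which leaves
    room for the unit. *)
Lemma majorization_transfer (s s' : seq nat) :
  sorted geq s -> sorted geq s' -> size s = size s' -> s <> s' ->
  psum s (size s) = psum s' (size s) ->
  (forall j, j <= size s -> psum s j <= psum s' j) ->
  exists p q, [/\ p < q, q < size s, nth 0 s' q < nth 0 s q,
    sorted geq (unit_transfer s p q) &
    (forall j, j <= size s -> psum (unit_transfer s p q) j <= psum s' j)].
Proof.
move=> ss ss' sz ne tot le_s.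
have sn := (geq_sorted_nth s).1 ss; have sn' := (geq_sorted_nth s').1 ss'.
have ex_p : exists i, nth 0 s i != nth 0 s' i.
  apply: contrapT => /forallNP H; apply: ne; apply: (@eq_from_nth _ 0) => // i _.
  by apply/eqP/negPn/negP/H.
case: (ex_minnP ex_p) => p np minp.
have pre i : i < p -> nth 0 s i = nth 0 s' i.
  by move=> ip; apply/eqP/negPn/negP => /minp; rewrite leqNgt ip.
have prep j : j <= p -> psum s j = psum s' j.
  by move=> jp; apply: eq_bigr => i _; apply: pre; apply: leq_trans jp.
have ps : p < size s.
  by rewrite ltnNge; apply: contra np => ge_p; rewrite !nth_default // -sz.
have ltp : nth 0 s p < nth 0 s' p.
  have := le_s p.+1 ps; rewrite !psumS prep // leq_add2l leq_eqVlt.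
  by rewrite (negPf np).
have ex_k : exists k, (p < k) && (psum s k == psum s' k).
  by exists (size s); rewrite ps tot eqxx.
case: (ex_minnP ex_k) => k /andP[pk /eqP ek] mink.
have ks : k <= size s by apply: mink; rewrite ps tot eqxx.
have strict j : p < j -> j < k -> psum s j < psum s' j.
  move=> pj jk; rewrite ltn_neqAle le_s ?(leq_trans (ltnW jk)) // andbT.
  by apply: contraL jk => ej; rewrite -leqNgt mink // pj.
case: k pk ek mink ks strict => // q pq ek mink qs strict.
(* If [p = q], sums that agree at both [p] and [p.+1] would force equal entries at [p]. *)
have {}pq : p < q.
  rewrite ltn_neqAle -ltnS pq andbT; apply: contraTneq ltp => pq'.
  by move: ek; rewrite !psumS -pq' prep // => /addnI ->; rewrite ltnn.
have ltq : nth 0 s' q < nth 0 s q.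
  by have := strict q pq (leqnn _); move: ek; rewrite !psumS; lia.
exists p, q; split=> //.
(* Order is at risk only before [p] and after [q]. There [s'] gives the slack: s_{p-1} = s'_{p-1} >=
   s'_p > s_p and s_q > s'_q >= s'_{q+1} >= s_{q+1}. *)
- apply/geq_sorted_nth => i; rewrite !nth_unit_transfer //.
  have := sn i.
  case: (eqVneq i.+1 p) => [ip|nip].
    have := pre i; rewrite -ip => /(_ (leqnn _)); have := sn' i.
    by move: ltp; rewrite -ip; lia.
  case: (eqVneq i q) => [iq|niq]; last by lia.
  subst i; have : nth 0 s q.+1 <= nth 0 s' q.+1; last first.
    by have := sn' q; lia.
  (* Past the end the entry of [s] is the default 0. Otherwise the sums agree at [q.+1], and
     dominance at [q.+2] compares the next entries. *)
  have [lt_q|ge_q] := ltnP q.+1 (size s); last by rewrite nth_default.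
  by have := le_s q.+2 lt_q; rewrite (psumS s q.+1) (psumS s' q.+1) ek; lia.
- move=> j js; rewrite psum_unit_transfer //; last by apply: leq_ltn_trans ltq.
  have := le_s j js; case: (boolP (p < j <= q)) => [/andP[pj jq]|_]; last by lia.
  by have := strict j pj jq; lia.
Qed.

Local Open Scope ring_scope.

(** * Increments of a good escalating function *)

Lemma MVT_pos (R : realType) (g : R -> R) (a b : R) :
  0 < a -> a < b -> (forall x, 0 < x -> derivable g x 1) ->
  exists2 c, a < c < b & g b - g a = derive1 g c * (b - a).
Proof.
move=> a0 ab dg.
have [||c] := @MVT _ g (derive1 g) a b ab.
- move=> x /[!in_itv]/= /andP[ax _]; rewrite derive1E.
  by apply/derivableP/dg/(lt_trans a0).
- apply: derivable_within_continuous => x /[!in_itv]/= /andP[ax _].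
  exact/dg/(lt_le_trans a0).
by rewrite in_itv /= => cab ->; exists c.
Qed.

Section Increments.
Variables (R : realType) (f : R -> R -> R).
Hypotheses (fsym : symmetric_pos f) (fgood : good_escalating f).

(** The difference D_t(s), at integer degrees. *)
Definition incr (t s : nat) : R := f t.+1%:R s%:R - f t%:R s%:R.

Lemma good_increasing (x y z : R) : 0 < x -> x < y -> 0 < z -> f x z < f y z.
Proof.
move=> x0 xy z0; case: fgood => _ d1 _ _.
have [c /andP[xc _] E] := MVT_pos x0 xy (fun t t0 => proj1 (d1 t z t0 z0)).
rewrite -subr_gt0 E mulr_gt0 ?subr_gt0 //.
by have [] := d1 c z (lt_trans x0 xc) z0.
Qed.

Lemma incr_gt0 t s : (0 < t)%N -> (0 < s)%N -> 0 < incr t s.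
Proof.
by move=> t0 s0; rewrite subr_gt0 good_increasing ?ltr0n ?ltr_nat.
Qed.

(** Growth in the second argument is escalation for the pairs [t'.+1], [t'] and [s'], [s]. Growth in
    the first is convexity: both increments are derivatives at intermediate points [c < c'], and the
    mean value theorem applies again to the derivative. *)
Lemma incr_le t t' s s' : (0 < t)%N -> (0 < s)%N -> (t <= t')%N -> (s <= s')%N ->
  incr t s <= incr t' s'.
Proof.
move=> t0 s0 tt' ss'; have t'0 := leq_trans t0 tt'; have s'0 := leq_trans s0 ss'.
apply: (@le_trans _ _ (incr t' s)); last first.
  case: fgood => /(_ t'.+1%:R s'%:R t'%:R s%:R) esc _ _ _; move: esc.
  rewrite !ltr0n !ler_nat leqnSn => /(_ t'0 isT s0 ss') [+ _].
  by rewrite (fsym (x := s'%:R)) ?ltr0n // /incr; lra.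
move: tt'; rewrite leq_eqVlt => /predU1P[->//|tt'].
case: fgood => _ d1 d2 _.
have s0' : 0 < s%:R :> R by rewrite ltr0n.
have dg x (x0 : 0 < x) := proj1 (d1 x s%:R x0 s0').
have dg2 x (x0 : 0 < x) := proj1 (d2 x s%:R x0 s0').
have t0' : 0 < t%:R :> R by rewrite ltr0n.
have t'0' : 0 < t'%:R :> R by rewrite ltr0n.
have tt : t%:R < t.+1%:R :> R by rewrite ltr_nat.
have tt1 : t'%:R < t'.+1%:R :> R by rewrite ltr_nat.
have [c /andP[tc ct] E] := MVT_pos t0' tt dg.
have [c' /andP[tc' ct'] E'] := MVT_pos t'0' tt1 dg.
have cc' : c < c'.
  by apply: lt_trans ct _; apply: le_lt_trans tc'; rewrite ler_nat.
rewrite /incr E E' -!natrB // !subSnn !mulr1 -subr_ge0.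
have [c2 /andP[cc2 _] ->] := MVT_pos (lt_trans t0' tc) cc' dg2.
rewrite mulr_ge0 ?subr_ge0 ?(ltW cc') //.
by have [] := d2 c2 _ (lt_trans (lt_trans t0' tc) cc2) s0'.
Qed.

End Increments.

(** Summing the domination over all pairs gives |A| sum_B g <= |B| sum_A h, and the right side is
    below |A| sum_A h since the last sum is positive. *)
Lemma ltr_sum_dominated (R : realFieldType) (I : finType) (A B : {pred I})
    (g h : I -> R) :
  (#|B| < #|A|)%N -> (forall a, a \in A -> 0 < h a) ->
  (forall a b, a \in A -> b \in B -> g b <= h a) ->
  \sum_(b in B) g b < \sum_(a in A) h a.
Proof.
move=> BA hpos dom.
have A0 : (0 < #|A|)%N by apply: leq_ltn_trans BA.
have hs : 0 < \sum_(a in A) h a.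
  case/card_gt0P: A0 => a aA; rewrite (bigD1 a) //= ltr_wpDr ?hpos //.
  by apply: sumr_ge0 => i /andP[iA _]; apply/ltW/hpos.
rewrite -(ltr_pM2l (x := #|A|%:R)) ?ltr0n //.
apply: (@le_lt_trans _ _ (#|B|%:R * \sum_(a in A) h a)); last first.
  by rewrite ltr_pM2r // ltr_nat.
rewrite !mulr_natl -!sumr_const exchange_big /=.
by apply: ler_sum => b bB; apply: ler_sum => a aA; apply: dom.
Qed.

(** * Weights under edge exchanges *)

Section Degrees.
Variable V : finType.
Implicit Types (e h : rel V) (a b u v w x y : V).

Definition degr e x : nat := #|[pred y | e x y]|.

Lemma degrE e x : degr e x = (\sum_y e x y)%N.
Proof.
rewrite /degr -sum1_card big_mkcond; apply: eq_bigr => y _.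
by rewrite inE; case: (e x y).
Qed.

Lemma add_edgeE e a b x y : a != b -> symmetric e -> ~~ e a b ->
  add_edge e a b x y = (e x y + (x == a) * (y == b) + (x == b) * (y == a))%N :> nat.
Proof.
move=> nab es nE; rewrite /add_edge.
have [/edge_predP[[-> ->]|[-> ->]]|] := boolP (edge_pred a b x y).
- by rewrite !eqxx (negPf nE) (negPf nab).
- by rewrite es !eqxx (negPf nE) eq_sym (negPf nab).
by rewrite negb_or !mulnb => /andP[/negPf-> /negPf->]; rewrite orbF !addn0.
Qed.

Lemma add_del_edge e a b x y : symmetric e -> e a b ->
  add_edge (del_edge e a b) a b x y = e x y.
Proof.
move=> es ab; rewrite /add_edge /del_edge.
by have [/edge_predP[[-> ->]|[-> ->]]|_] := boolP (edge_pred a b x y);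
  rewrite ?orbT ?andbT ?orbF // 1?es ab.
Qed.

Lemma del_edge_self e a b : ~~ del_edge e a b a b.
Proof. by rewrite /del_edge /edge_pred !eqxx andbF. Qed.

Lemma degr_add_edge e a b x : a != b -> symmetric e -> ~~ e a b ->
  degr (add_edge e a b) x = (degr e x + (x == a) + (x == b))%N.
Proof.
move=> nab es nE; rewrite !degrE.
under eq_bigr do rewrite add_edgeE //.
rewrite !big_split /= -!big_distrr /=.
have one c : (\sum_y (y == c) = 1)%N.
  by rewrite (bigD1 c) //= eqxx big1 // => i /negPf->.
by rewrite !one !muln1.
Qed.

Lemma degr_del_edge e a b x : a != b -> symmetric e -> e a b ->
  degr e x = (degr (del_edge e a b) x + (x == a) + (x == b))%N.
Proof.
move=> nab es ab; rewrite -degr_add_edge ?del_edge_self //; last exact: del_edge_sym.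
by apply: eq_card => y; rewrite !inE add_del_edge.
Qed.

Lemma degr_gt0 e u v : u != v -> (forall x y, connect e x y) ->
  forall x, (0 < degr e x)%N.
Proof.
move=> nuv ec x.
have [z nxz] : exists z, x != z.
  have [<-|nxu] := eqVneq u x; first by exists v.
  by exists u; rewrite eq_sym.
case/connectP: (ec x z) nxz => -[|t p] /=; first by move=> _ ->; rewrite eqxx.
by case/andP=> xt _ _ _; apply/card_gt0P; exists t; rewrite inE.
Qed.

Section AdjacencySums.
Variable R : numDomainType.
Implicit Type F : V -> V -> R.

(** The sum runs over ordered pairs, so each edge counts twice; with indicators, adding or deleting
    an edge changes it additively. *)
Definition adj_sum e F : R := \sum_x \sum_y (e x y)%:R * F x y.

Lemma adj_sum_add_edge e a b F : a != b -> symmetric e -> ~~ e a b ->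
  adj_sum (add_edge e a b) F = adj_sum e F + F a b + F b a.
Proof.
move=> nab es nE; rewrite /adj_sum.
have pick (c d : V) : \sum_x \sum_y ((x == c) * (y == d))%N%:R * F x y = F c d.
  rewrite (bigD1 c) //= (bigD1 d) //= !eqxx mul1r !big1 ?addr0 //.
    by move=> x /negPf xc; apply: big1 => y _; rewrite xc mul0n mul0r.
  by move=> y /negPf yd; rewrite yd muln0 mul0r.
rewrite -[F a b]pick -[F b a]pick -!big_split /=; apply: eq_bigr => x _.
rewrite -!big_split /=; apply: eq_bigr => y _.
by rewrite add_edgeE // !natrD !mulrDl.
Qed.

Lemma adj_sum_del_edge e a b F : a != b -> symmetric e -> e a b ->
  adj_sum (del_edge e a b) F = adj_sum e F - F a b - F b a.
Proof.
move=> nab es ab.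
have -> : adj_sum e F = adj_sum (add_edge (del_edge e a b) a b) F.
  by apply: eq_bigr => x _; apply: eq_bigr => y _; rewrite add_del_edge.
rewrite adj_sum_add_edge ?del_edge_self //; last exact: del_edge_sym.
by rewrite [_ + F a b + _]addrAC !addrK.
Qed.

(** By symmetry the two rows and the two columns carry the same entries, hence the factor 2; the
    entry at [u v] lies in both rows and is split off. *)
Lemma sum_two_rows (W : V -> V -> R) u v : u != v ->
  (forall x y, W x y = W y x) -> W u u = 0 -> W v v = 0 ->
  (forall x y, x != u -> x != v -> y != u -> y != v -> W x y = 0) ->
  \sum_x \sum_y W x y =
  (\sum_(y | y != v) W u y + \sum_(y | y != u) W v y + W u v) *+ 2.
Proof.
move=> nuv Ws Wu Wv W0.
have nvu : v != u by rewrite eq_sym.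
rewrite (bigD1 u) //= [X in _ + X](bigD1 v) //=.
have -> : \sum_(i | (i != u) && (i != v)) \sum_y W i y =
    \sum_(i | (i != u) && (i != v)) (W u i + W v i).
  apply: eq_bigr => x /andP[xu xv].
  rewrite (bigD1 u) //= (bigD1 v) //= big1 ?addr0 => [|y /andP[yu yv]].
    by rewrite (Ws x u) (Ws x v).
  exact: W0.
rewrite big_split /=.
rewrite [\sum_y W u y](bigD1 v) //= [\sum_y W v y](bigD1 u) //=.
rewrite [\sum_(y | y != v) W u y](bigD1 u) //= [\sum_(y | y != u) W v y](bigD1 v) //=.
rewrite Wu Wv !add0r (Ws v u).
under [\sum_(i | (i != v) && (i != u)) _]eq_bigl do rewrite andbC.
by set X := \sum_(_ | _) _; set Y := \sum_(_ | _) W v _; rewrite mulr2n; ring.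
Qed.

End AdjacencySums.

Lemma degr_switch_edges e u x v y t : symmetric e -> irreflexive e ->
  u != v -> e u x -> e v y -> ~~ e u y -> ~~ e v x -> u != y -> v != x ->
  degr (switch_edges e u x v y) t = degr e t.
Proof.
move=> es ei nuv ux vy nuy nvx uy vx.
have nux : u != x by apply: contraTneq ux => <-; rewrite ei.
have nvy : v != y by apply: contraTneq vy => <-; rewrite ei.
have d1s : symmetric (del_edge e u x) by apply: del_edge_sym.
have d2s : symmetric (del_edge (del_edge e u x) v y) by apply: del_edge_sym.
have d3s := add_edge_sym u y d2s.
rewrite /switch_edges !degr_add_edge //.
- have vy1 : del_edge e u x v y.
    by rewrite /del_edge vy /= /edge_pred eq_sym (negPf nuv) (negPf vx).
  have := degr_del_edge t nvy d1s vy1; have := degr_del_edge t nux es ux.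
  move: (t == u) (t == x) (t == v) (t == y) => [] [] [] []; lia.
- by rewrite /del_edge (negPf nuy).
- rewrite /add_edge /del_edge (negPf nvx) /edge_pred.
  by rewrite eq_sym (negPf nuv) (negPf nvy).
Qed.

Lemma adj_sum_switch_edges (R : numDomainType) e u x v y (F : V -> V -> R) :
  symmetric e -> irreflexive e ->
  u != v -> e u x -> e v y -> ~~ e u y -> ~~ e v x -> u != y -> v != x ->
  (forall s t, F s t = F t s) ->
  adj_sum (switch_edges e u x v y) F =
  adj_sum e F + (F u y + F v x - F u x - F v y) *+ 2.
Proof.
move=> es ei nuv ux vy nuy nvx uy vx Fs.
have nux : u != x by apply: contraTneq ux => <-; rewrite ei.
have nvy : v != y by apply: contraTneq vy => <-; rewrite ei.
have d1s : symmetric (del_edge e u x) by apply: del_edge_sym.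
have d2s : symmetric (del_edge (del_edge e u x) v y) by apply: del_edge_sym.
have d3s := add_edge_sym u y d2s.
have vy1 : del_edge e u x v y.
  by rewrite /del_edge vy /= /edge_pred eq_sym (negPf nuv) (negPf vx).
rewrite /switch_edges !adj_sum_add_edge //; last first.
- rewrite /add_edge /del_edge (negPf nvx) /edge_pred.
  by rewrite eq_sym (negPf nuv) (negPf nvy).
- by rewrite /del_edge (negPf nuy).
rewrite !adj_sum_del_edge // (Fs y u) (Fs x v) (Fs x u) (Fs y v) mulr2n; ring.
Qed.

Lemma degr_move_edge e u v w t : symmetric e -> irreflexive e ->
  e v w -> ~~ e u w -> u != w ->
  (degr (add_edge (del_edge e v w) u w) t + (t == v) = degr e t + (t == u))%N.
Proof.
move=> es ei vw nuw uw.
have nvw : v != w by apply: contraTneq vw => <-; rewrite ei.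
rewrite degr_add_edge //; first have := degr_del_edge t nvw es vw.
- by move: (t == u) (t == w) (t == v) => [] [] []; lia.
- exact: del_edge_sym.
- by rewrite /del_edge (negPf nuw).
Qed.

End Degrees.

Section Weights.
Variables (R : realType) (f : R -> R -> R) (V : finType).
Hypotheses (fsym : symmetric_pos f) (fgood : good_escalating f).
Implicit Types (e h : rel V) (a b u v w x y : V).

Definition weight e : R :=
  adj_sum e (fun x y => f (degr e x)%:R (degr e y)%:R).

(** The competitors are labelled: every vertex keeps its own degree. Edge switches stay inside this
    class. *)
Definition degree_maximal e := forall h, tree_rel h ->
  (forall x, degr h x = degr e x) -> weight h <= weight e.

(** Otherwise the switch would give the larger neighbour [y] to the larger vertex [u], and strict
    escalation would raise the weight at unchanged degrees. *)
Lemma switch_dominated e u x v y : tree_rel e -> degree_maximal e ->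
  (degr e v < degr e u)%N -> e u x -> e v y -> ~~ e u y -> ~~ e v x ->
  u != y -> v != x ->
  connect (del_edge (del_edge e u x) v y) u v \/
  connect (del_edge (del_edge e u x) v y) x y ->
  (degr e y <= degr e x)%N.
Proof.
move=> et emax dvu ux vy nuy nvx uy vx cc; rewrite leqNgt; apply/negP => dxy.
have [es ei ec _] := et.
have nuv : u != v by apply: contraTneq dvu => ->; rewrite ltnn.
have pos : forall z, 0 < (degr e z)%:R :> R.
  by move=> z; rewrite ltr0n (degr_gt0 nuv ec).
have deq t := degr_switch_edges t es ei nuv ux vy nuy nvx uy vx.
have nxy : x != y by apply: contraNneq nuy => <-.
have := emax _ (switch_edges_tree et nuv uy vx nxy ux vy cc) deq.
have -> : weight (switch_edges e u x v y) = adj_sum (switch_edges e u x v y)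
    (fun x y => f (degr e x)%:R (degr e y)%:R).
  by apply: eq_bigr => s _; apply: eq_bigr => t _; rewrite !deq.
rewrite adj_sum_switch_edges //; last by move=> s t; apply: fsym.
rewrite /weight.
case: fgood => /(_ (degr e u)%:R (degr e y)%:R (degr e v)%:R (degr e x)%:R) esc _ _ _.
have [] := esc; rewrite ?ltr_nat ?ler_nat ?(ltnW dvu) ?(ltnW dxy) ?pos //.
move=> _ /(_ dvu dxy); rewrite (fsym (x := (degr e y)%:R)) //.
rewrite mulr2n; lra.
Qed.

(** The change over the edges at [u], apart from a possible edge to [v], when the degree of [u] goes
    from [k] to [k.+1] and the neighbours keep theirs. *)
Definition row_sum e u v k : R :=
  \sum_(y | e u y && (y != v)) incr f k (degr e y).

Lemma weight_move_edge e u v w : tree_rel e -> u != v -> (1 < degr e v)%N ->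
  e v w -> ~~ e u w -> u != w ->
  weight (add_edge (del_edge e v w) u w) = weight e +
  (row_sum e u v (degr e u) - row_sum e v u (degr e v).-1
   + (e u v)%:R * (f (degr e u).+1%:R (degr e v).-1%:R
                   - f (degr e u)%:R (degr e v)%:R)
   + f (degr e u).+1%:R (degr e w)%:R - f (degr e v).-1%:R (degr e w)%:R) *+ 2.
Proof.
move=> [es ei ec _] nuv dv2 vw nuw uw; set h := add_edge _ _ _.
have nvw : v != w by apply: contraTneq vw => <-; rewrite ei.
have nvu : v != u by rewrite eq_sym.
have deg_h t : degr h t = (degr e t + (t == u) - (t == v))%N.
  by rewrite -(degr_move_edge t es ei vw nuw uw) addnK.
have hu : degr h u = (degr e u).+1 by rewrite deg_h eqxx (negPf nuv) addn1 subn0.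
have hv : degr h v = (degr e v).-1 by rewrite deg_h eqxx (negPf nvu) addn0 subn1.
have ho t : t != u -> t != v -> degr h t = degr e t.
  by move=> tu tv; rewrite deg_h (negPf tu) (negPf tv) addn0 subn0.
have hw : degr h w = degr e w by apply: ho; rewrite eq_sym.
have pos := degr_gt0 nuv ec.
have hpos t : (0 < degr h t)%N.
  rewrite deg_h; have := pos t; have [->|_] := eqVneq t v; last by lia.
  by rewrite (negPf nvu); lia.
pose F x y := f (degr e x)%:R (degr e y)%:R.
pose F' x y := f (degr h x)%:R (degr h y)%:R.
have Fs x y : F x y = F y x by apply: fsym; rewrite ltr0n.
have F's x y : F' x y = F' y x by apply: fsym; rewrite ltr0n.
(* The change is taken in two stages: the old edges are re-evaluated at the new degrees, which
   affects only the rows of [u] and [v]; then [v w] is replaced by [u w]. *)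
pose W x y := (e x y)%:R * (F' x y - F x y).
have step : weight h = weight e + \sum_x \sum_y W x y + (F' u w - F' v w) *+ 2.
  have -> : weight h = adj_sum e F' + (F' u w - F' v w) *+ 2.
    rewrite /weight -/F' adj_sum_add_edge ?adj_sum_del_edge //.
    - rewrite (F's w u) (F's w v) mulr2n; ring.
    - exact: del_edge_sym.
    - by rewrite /del_edge (negPf nuw).
  congr (_ + _); rewrite /weight -/F /adj_sum -big_split; apply: eq_bigr => x _.
  rewrite -big_split; apply: eq_bigr => y _; rewrite /W /=; ring.
rewrite step (@sum_two_rows _ _ _ u v) //; first last.
- move=> x y xu xv yu yv; rewrite /W /F /F' !ho //; ring.
- by rewrite /W ei mul0r.
- by rewrite /W ei mul0r.
- by move=> x y; rewrite /W es Fs F's.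
have -> : \sum_(y | y != v) W u y = row_sum e u v (degr e u).
  rewrite /row_sum big_mkcondl; apply: eq_bigr => y yv; rewrite /W.
  case: ifPn => uy; rewrite ?mul0r // mul1r /F /F' /incr hu ho //.
  by apply: contraTneq uy => ->; rewrite ei.
(* The degree of [v] falls, so its increments start at the predecessor and enter negatively. *)
have -> : \sum_(y | y != u) W v y = - row_sum e v u (degr e v).-1.
  rewrite /row_sum -sumrN big_mkcondl; apply: eq_bigr => y yu; rewrite /W.
  case: ifPn => vy; rewrite ?mul0r // mul1r /F /F' /incr hv ho //; last first.
    by apply: contraTneq vy => ->; rewrite ei.
  by rewrite prednK ?opprB // pos.
rewrite /W /F /F' hu hv hw !mulr2n; ring.
Qed.

End Weights.

(** * The gain of a unit transfer in a degree-maximal tree *)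

Section Transfer.
Variables (R : realType) (f : R -> R -> R) (V : finType).
Hypotheses (fsym : symmetric_pos f) (fgood : good_escalating f).
Implicit Types (e h : rel V) (a b u v w x y : V).
Local Notation weight := (weight f).
Local Notation row_sum := (row_sum f).
Local Notation incr := (incr f).

(** The condition on the rows discards the term of [w] itself, turning the remaining f(d(v)-1, d(w))
    of the gain into f(d(v), d(w)). *)
Lemma move_improves e u v p q : tree_rel e -> path_ends e u v p q -> u != v ->
  (degr e v <= degr e u)%N -> (1 < degr e v)%N ->
  (forall w, e v w -> w != q ->
     row_sum e v u (degr e v).-1 - incr (degr e v).-1 (degr e w)
     < row_sum e u v (degr e u)) ->
  exists h, [/\ tree_rel h, weight e < weight h &
    forall t, (degr h t + (t == v) = degr e t + (t == u))%N].
Proof.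
move=> et pe nuv dvu dv rows; have [es ei ec eb] := et.
have pos := degr_gt0 nuv ec.
have [w /andP[vw wq]] : exists w, e v w && (w != q).
  have /card_gt0P[w] : (0 < #|[pred y | e v y & y != q]|)%N.
    move: dv; rewrite /degr (cardD1 q) inE (pe_vq pe) ltnS.
    by congr (0 < _)%N; apply: eq_card => y; rewrite !inE andbC.
  by rewrite inE => ww; exists w.
have [nwu wu] := pe_v pe vw wq.
have nuw : ~~ e u w by rewrite es.
have uw : u != w by rewrite eq_sym.
have cuv : connect (del_edge e v w) u v.
  (* Taking [u] itself for the branch of [u] deletes only a loop, so the path is seen to survive the
     deletion of [v w]. *)
  have npu : u != p by apply: contraTneq (pe_up pe) => <-; rewrite ei.
  apply: connect_subrel (pe_conn pe npu wq) => s t /andP[/andP[st _] n].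
  by apply/andP.
exists (add_edge (del_edge e v w) u w); split.
- split.
  + exact/add_edge_sym/del_edge_sym.
  + exact/add_edge_irr/del_edge_irr.
  + exact: move_edge_conn.
  + exact: move_edge_bridged.
- rewrite weight_move_edge // ltrDl pmulrn_lgt0 //.
  have := rows w vw wq; rewrite /incr prednK; last exact: ltnW.
  set X := row_sum _ _ _ _; set Y := row_sum _ _ _ _.
  have wpos : 0 < (degr e w)%:R :> R by rewrite ltr0n.
  have vpos : 0 < (degr e v)%:R :> R by rewrite ltr0n.
  have [uv|_] := boolP (e u v).
    (* The last condition of good escalation, at d(u), d(w), d(v), is exactly what bounds the
       leftover terms when [u v] is an edge. *)
    case: fgood => _ _ _ /(_ (degr e u)%:R (degr e w)%:R (degr e v)%:R).
    rewrite ltr1n ler_nat ler1n => /(_ dv dvu (pos w)).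
    have -> : (degr e v)%:R - 1 = (degr e v).-1%:R :> R.
      by rewrite -subn1 natrB // ltnW.
    rewrite natr1 (fsym (x := (degr e w)%:R)) //.
    rewrite mul1r; lra.
  have : f (degr e v)%:R (degr e w)%:R < f (degr e u).+1%:R (degr e w)%:R.
    by apply: good_increasing; rewrite // ltr_nat ltnS.
  rewrite mul0r; lra.
- by move=> t; rewrite degr_move_edge.
Qed.

Lemma row_sum_gt_eq e u v w : tree_rel e -> u != v -> (1 < degr e v)%N ->
  row_sum e v u (degr e v) <= row_sum e u v (degr e v) -> e v w -> w != u ->
  row_sum e v u (degr e v).-1 - incr (degr e v).-1 (degr e w)
  < row_sum e u v (degr e v).
Proof.
move=> et nuv dv le_rows vw wu; have pos := degr_gt0 nuv (tree_conn et).
have k0 : (0 < (degr e v).-1)%N by rewrite -subn1 subn_gt0.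
rewrite ltrBlDr; apply: (le_lt_trans (y := row_sum e u v (degr e v))).
  apply: le_trans le_rows; apply: ler_sum => y _.
  by apply: incr_le; rewrite ?leq_pred.
by rewrite ltrDl incr_gt0.
Qed.

(** Off the path [u] has d(u) - 1 branches and [v], without [w], has d(v) - 2. Each increment of the
    former dominates each of the latter, so the smaller number decides. *)
Lemma row_sum_gt_lt e u v p q w : tree_rel e -> degree_maximal f e ->
  path_ends e u v p q ->
  (degr e v < degr e u)%N -> (1 < degr e v)%N -> e v w -> w != q ->
  row_sum e v u (degr e v).-1 - incr (degr e v).-1 (degr e w)
  < row_sum e u v (degr e u).
Proof.
move=> et emax pe dvu dv vw wq; have [es ei ec eb] := et.
have nuv : u != v by apply: contraTneq dvu => ->; rewrite ltnn.
have pos := degr_gt0 nuv ec.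
have k0 : (0 < (degr e v).-1)%N by rewrite -subn1 subn_gt0.
have ku : ((degr e v).-1 <= degr e u)%N by apply: leq_trans (ltnW dvu); apply: leq_pred.
pose A := [pred y | e u y & y != p].
pose B := [pred y | (e v y) && (y != q) & y != w].
have cardA : degr e u = #|A|.+1.
  rewrite /degr (cardD1 p) inE (pe_up pe); congr _.+1.
  by apply: eq_card => y; rewrite !inE andbC.
have cardB : degr e v = #|B|.+2.
  rewrite /degr (cardD1 q) inE (pe_vq pe) (cardD1 w) !inE vw wq; congr _.+2.
  by apply: eq_card => y; rewrite !inE andbC (andbC (_ != q)).
have branches : \sum_(y in B) incr (degr e v).-1 (degr e y) <
    \sum_(y in A) incr (degr e u) (degr e y).
  apply: ltr_sum_dominated.
  - by move: dvu; rewrite cardA cardB ltnS => /ltnW.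
  - by move=> a _; apply: incr_gt0.
  - move=> a b; rewrite !inE => /andP[ua ap] /andP[/andP[vb bq] bw].
    have [nav av] := pe_u pe ua ap; have [nbu bu] := pe_v pe vb bq.
    apply: incr_le => //.
    apply: (switch_dominated fsym fgood et emax dvu ua vb).
    + by rewrite es.
    + by rewrite es.
    + by rewrite eq_sym.
    + by rewrite eq_sym.
    + by left; apply: (pe_conn pe).
have rowv : \sum_(y | e v y && (y != q)) incr (degr e v).-1 (degr e y) =
    incr (degr e v).-1 (degr e w) + \sum_(y in B) incr (degr e v).-1 (degr e y).
  by rewrite (bigD1 w) ?vw.
(* For adjacent [u] and [v] the path neighbours are [v] and [u] themselves, which the row sums omit;
   otherwise [p] and [q] each add one more term. *)
case: (pe_cases pe) => [[uv [pv qu]]|[nuv' cpq]].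
  have -> : row_sum e v u (degr e v).-1 =
      \sum_(y | e v y && (y != q)) incr (degr e v).-1 (degr e y) by rewrite qu.
  rewrite rowv addrAC subrr add0r; apply: (lt_le_trans branches).
  by rewrite /A pv.
have nvu' : ~~ e v u by rewrite es.
have drop_cond s t : ~~ e s t ->
    forall k, row_sum e s t k = \sum_(y | e s y) incr k (degr e y).
  move=> st k; apply: eq_bigl => y; case: (boolP (e s y)) => //= sy.
  by apply: contraNneq st => <-.
rewrite !drop_cond // (bigD1 q (pe_vq pe)) (bigD1 p (pe_up pe)) /= rowv.
(* Either [p] and [q] coincide, or the edges [u p] and [v q] can be switched because the inner path
   still joins [p] to [q]. *)
have : incr (degr e v).-1 (degr e q) <= incr (degr e u) (degr e p).
  apply: incr_le => //; have [-> //|npq] := eqVneq p q.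
  apply: (switch_dominated fsym fgood et emax dvu (pe_up pe) (pe_vq pe)).
  - apply/negP => uq; have [] := pe_u pe uq; first by rewrite eq_sym.
    by rewrite es (pe_vq pe).
  - apply/negP => vp; have [] := pe_v pe vp => //.
    by rewrite es (pe_up pe).
  - by apply: contraNneq nvu' => ->; apply: pe_vq pe.
  - by apply: contraNneq nuv' => ->; apply: pe_up pe.
  - by right.
have -> : \sum_(y | e u y && (y != p)) incr (degr e u) (degr e y) =
    \sum_(y in A) incr (degr e u) (degr e y) by [].
move: branches; lra.
Qed.

(** The second alternative, for equal degrees, moves the unit the other way; both outcomes give the
    same multiset of degrees. *)
Lemma transfer_improves e u v : tree_rel e -> degree_maximal f e -> u != v ->
  (degr e v <= degr e u)%N -> (1 < degr e v)%N ->
  exists h, [/\ tree_rel h, weight e < weight h &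
    (forall t, (degr h t + (t == v) = degr e t + (t == u))%N) \/
    (degr e u = degr e v /\
     forall t, (degr h t + (t == u) = degr e t + (t == v))%N)].
Proof.
move=> et emax nuv dvu dv.
have [p [q pe]] := path_ends_exist et nuv.
move: dvu; rewrite leq_eqVlt => /predU1P[dvu|dvu]; last first.
  have [|h [ht hw hd]] := move_improves et pe nuv (ltnW dvu) dv.
    by move=> w vw wq; apply: row_sum_gt_lt pe dvu dv vw wq.
  by exists h; split=> //; left.
wlog le_rows : u v p q pe nuv dv dvu / row_sum e v u (degr e v) <= row_sum e u v (degr e v).
  move=> H; have [le|/ltW ge] := lerP (row_sum e v u (degr e v)) (row_sum e u v (degr e v)).
    exact: H pe nuv dv dvu le.
  have nvu : v != u by rewrite eq_sym.
  have [q' [p' pe']] := path_ends_exist et nvu.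
  have [|||h [ht hw hd]] := H v u q' p' pe' nvu; rewrite -?dvu //.
  exists h; split=> //; case: hd => [hd|[_ hd]]; last by left.
  by right; rewrite dvu.
have [|h [ht hw hd]] := move_improves et pe nuv (eq_leq dvu) dv.
  move=> w vw wq; rewrite -dvu; apply: row_sum_gt_eq => //.
  by have [] := pe_v pe vw wq.
by exists h; split=> //; left.
Qed.

End Transfer.

(** Swapping endpoints matches the pairs in increasing rank with those in decreasing rank, and equal
    ranks would be a loop. *)
Lemma Mf_weight (R : realType) (f : R -> R -> R) (G : sgraph) :
  symmetric_pos f -> Mf f G *+ 2 = weight f (@adj G).
Proof.
move=> fsym; pose F (z : G * G) := f (deg z.1)%:R (deg z.2)%:R.
pose lt_rank (z : G * G) := (enum_rank z.1 < enum_rank z.2)%N.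
have Fswap z : adj z.1 z.2 -> F (z.2, z.1) = F z.
  move=> zz; apply: fsym; rewrite ltr0n; apply/card_gt0P.
    by exists z.1; rewrite inE adj_sym.
  by exists z.2; rewrite inE.
have -> : weight f (@adj G) = \sum_(z | adj z.1 z.2) F z.
  rewrite /weight /adj_sum pair_big /= [RHS]big_mkcond /=; apply: eq_bigr => z _.
  by case: (adj _ _); rewrite ?mul1r ?mul0r.
rewrite (bigID lt_rank) /= mulr2n; congr (_ + _).
rewrite /Mf -/F (reindex_inj (h := fun z : G * G => (z.2, z.1))) /=; last first.
  by case=> a b [c d] [-> ->].
apply: eq_big => [z|z /andP[zz _]]; last by rewrite -[LHS]/(F (z.2, z.1)) Fswap // adj_sym.
rewrite adj_sym; case: (boolP (adj z.1 z.2)) => //= zz.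
rewrite /lt_rank -leqNgt [RHS]leq_eqVlt orb_idl // => /eqP/val_inj/enum_rank_inj z12.
by move: zz; rewrite z12 adj_irr.
Qed.

(** * Chains of unit transfers and the comparison of extremal trees *)

Section Main.
Variables (R : realType) (f : R -> R -> R) (V : finType).
Hypotheses (fsym : symmetric_pos f) (fgood : good_escalating f).
Implicit Types (e h : rel V) (u v x y : V).

Definition degree_list e := sort geq [seq degr e x | x <- enum V].

Lemma degree_maximal_exists e : tree_rel e ->
  exists h, [/\ tree_rel h, degree_maximal f h, weight f e <= weight f h &
    forall x, degr h x = degr e x].
Proof.
(* Relations are coded as sets of pairs, a finite type over which a maximum exists. *)
move=> et; pose rel_of (E : {set V * V}) : rel V := fun x y => (x, y) \in E.
have rel_ofK h : rel_of [set z | h z.1 z.2] = h.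
  by apply/funext => x; apply/funext => y; rewrite /rel_of inE.
pose P E := `[< tree_rel (rel_of E) /\ forall x, degr (rel_of E) x = degr e x >].
have PP h : tree_rel h -> (forall x, degr h x = degr e x) -> P [set z | h z.1 z.2]%SET.
  by move=> ht hd; apply/asboolP; rewrite rel_ofK.
have [E /asboolP[Et Ed] Emax] := @arg_maxP _ _ _ _ P (fun E => weight f (rel_of E))
  (PP e et (fun=> erefl)).
exists (rel_of E); split=> //.
- move=> h ht hd; have := Emax _ (PP h ht (fun x => etrans (hd x) (Ed x))).
  by rewrite rel_ofK.
- by have := Emax _ (PP e et (fun=> erefl)); rewrite rel_ofK.
Qed.

Lemma degree_list_eqP e s : sorted geq s ->
  perm_eq [seq degr e x | x <- enum V] s -> degree_list e = s.
Proof.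
move=> ss ps; apply: (sorted_eq (leT := geq)) => //.
- by move=> a b c ba cb; apply: leq_trans cb ba.
- by move=> a b /andP[ab ba]; apply: anti_leq; apply/andP.
- by apply: sort_sorted => a b; apply: leq_total.
- by rewrite perm_sort.
Qed.

Lemma transfer_degree_list e p q : tree_rel e -> degree_maximal f e ->
  let s := degree_list e in
  (p < q)%N -> (q < size s)%N -> (1 < nth 0 s q)%N ->
  sorted geq (unit_transfer s p q) ->
  exists h, [/\ tree_rel h, weight f e < weight f h &
    degree_list h = unit_transfer s p q].
Proof.
move=> et emax s pq qs sq sorted_t.
(* Sorting the vertices by degree turns the positions [p] and [q] into vertices. *)
pose vs := sort (relpre (degr e) geq) (enum V).
have s_vs : s = map (degr e) vs by rewrite /s /degree_list sort_map.
have perm_vs : perm_eq vs (enum V) by rewrite perm_sort.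
have uniq_vs : uniq vs by rewrite (perm_uniq perm_vs) enum_uniq.
have size_vs : size vs = size s by rewrite s_vs size_map.
have ps := ltn_trans pq qs.
have [x0 _] : exists x0 : V, x0 \in vs.
  by case: (vs) size_vs => [|x l] E; [rewrite -E in qs | exists x; rewrite mem_head].
pose u := nth x0 vs p; pose v := nth x0 vs q.
have nth_s i : (i < size s)%N -> degr e (nth x0 vs i) = nth 0%N s i.
  by move=> i_s; rewrite s_vs (nth_map x0) ?size_vs.
have nuv : u != v by rewrite nth_uniq ?size_vs // ltn_eqF.
have dvu : (degr e v <= degr e u)%N.
  rewrite !nth_s //.
  have := @sorted_ltn_nth _ geq (fun _ _ _ ba cb => leq_trans cb ba) 0%N s; apply=> //.
  by apply: sort_sorted => a b; apply: leq_total.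
have dv : (1 < degr e v)%N by rewrite nth_s.
have [h [ht hw hd]] := transfer_improves fsym fgood et emax nuv dvu dv.
exists h; split=> //; apply: degree_list_eqP => //.
pose g t := (degr e t + (t == u) - (t == v))%N.
have map_g : map g vs = unit_transfer s p q.
  apply: (@eq_from_nth _ 0%N) => [|i]; rewrite size_map size_vs ?size_unit_transfer // => i_s.
  rewrite (nth_map x0) ?size_vs // nth_unit_transfer // /g nth_s //.
  by rewrite !nth_uniq ?size_vs.
rewrite -map_g; apply: perm_trans (perm_map g (_ : perm_eq (enum V) vs)); last first.
  by rewrite perm_sym.
case: hd => [hd|[duv hd]].
  rewrite (_ : map (degr h) _ = map g (enum V)) //; apply: eq_map => t.
  by rewrite /g -hd addnK.
(* For equal degrees the reversed transfer is the intended one after swapping [u] and [v], so the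
   degrees are only permuted. *)
have hE t : degr h t = g (tperm u v t).
  have -> : degr h t = (degr e t + (t == v) - (t == u))%N by rewrite -hd addnK.
  rewrite /g; case: tpermP => [->|->|/eqP/negPf tu /eqP/negPf tv].
  - by rewrite !eqxx duv (negPf nuv) eq_sym (negPf nuv).
  - by rewrite !eqxx duv (negPf nuv) eq_sym (negPf nuv).
  - by rewrite tu tv.
rewrite (eq_map hE) (map_comp g); apply: perm_map.
apply: uniq_perm; rewrite ?(map_inj_uniq (@perm_inj _ _)) ?enum_uniq //.
by move=> t; rewrite mem_enum -(tpermK u v t) map_f // mem_enum.
Qed.

(** Induction on the total gap between partial sums; each round passes to a degree-maximal tree and
    then makes one transfer. The guard on positivity allows for the one-vertex tree, whose only
    degree is 0. *)
Lemma majorized_improves (s' : seq nat) e : tree_rel e ->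
  sorted geq s' -> ((1 < size s')%N -> forall i, (i < size s')%N -> (0 < nth 0 s' i)%N) ->
  majorized (degree_list e) s' ->
  exists h, [/\ tree_rel h, degree_list h = s' & weight f e < weight f h].
Proof.
move=> + ss' pos'.
pose gap e := (\sum_(j < (size s').+1) (psum s' j - psum (degree_list e) j))%N.
have [m] := ubnP (gap e); elim: m e => // m IH e gap_m et [ne sz tot le_s].
have [e0 [et0 emax0 we0 de0]] := degree_maximal_exists et.
have dl0 : degree_list e0 = degree_list e.
  by rewrite /degree_list; congr sort; apply: eq_map.
set s := degree_list e in ne sz tot le_s dl0.
have ss : sorted geq s by apply: sort_sorted => a b; apply: leq_total.
have [p [q [pq qs ltq sorted_t le_t]]] := majorization_transfer ss ss' sz ne tot le_s.
have sq : (1 < nth 0 s q)%N.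
  by apply: leq_ltn_trans ltq; rewrite pos' // -sz //
    (leq_ltn_trans _ qs) // (leq_ltn_trans _ pq).
have [h [ht wh dh]] : exists h, [/\ tree_rel h, weight f e0 < weight f h &
    degree_list h = unit_transfer s p q].
  by have := @transfer_degree_list e0 p q et0 emax0; rewrite dl0; apply.
have weh := le_lt_trans we0 wh.
have [hs'|/eqP nhs'] := eqVneq (unit_transfer s p q) s'.
  by exists h; split=> //; rewrite dh.
have sq0 := ltnW sq.
have psum_t j := psum_unit_transfer j pq qs sq0.
have [|||h' [ht' dh' wh']] := IH h => //.
- rewrite -ltnS; apply: leq_ltn_trans gap_m; rewrite /gap dh.
  (* The partial sum of length [q] rises by one under the transfer, so the gap strictly decreases
     there. *)
  have qs' : (q < (size s').+1)%N by rewrite -sz ltnS ltnW.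
  rewrite (bigD1 (Ordinal qs')) //= [X in (_ < X)%N](bigD1 (Ordinal qs')) //=.
  rewrite -addSn leq_add //.
    have := le_t q (ltnW qs); rewrite psum_t pq leqnn -/s addn1; lia.
  by apply: leq_sum => j _; rewrite psum_t leq_sub2l // leq_addr.
- rewrite dh; split; rewrite ?size_unit_transfer //.
  rewrite -/(psum _ _) psum_t (leqNgt (size s) q) qs andbF addn0; exact: tot.
by exists h'; split=> //; apply: lt_trans weh wh'.
Qed.

End Main.

Theorem theorem5 (R : realType) (f : R -> R -> R) (pi pi' : seq nat)
    (T T' : sgraph) :
  symmetric_pos f -> good_escalating f ->
  tree_degree_seq pi -> tree_degree_seq pi' -> majorized pi pi' ->
  extremal_tree f pi T -> extremal_tree f pi' T' ->
  Mf f T < Mf f T'.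
Proof.
move=> fsym fgood _ _ maj [[[T0 Tc] Ta] [_ dT] _] [_ [[_ T'c] dT'] T'max].
have Tt : tree_rel (@adj T).
  by split=> //; [apply: adj_sym | apply: adj_irr | apply: acyclic_bridged].
have ss' : sorted geq pi'.
  by rewrite -dT'; apply: sort_sorted => a b; apply: leq_total.
have pos' : (1 < size pi')%N -> forall i, (i < size pi')%N -> (0 < nth 0 pi' i)%N.
  rewrite -{1}dT' size_sort size_map -cardE => /card_gt1P[u [v [_ _ nuv]]] i ipi.
  have /mapP[x _ ->] : nth 0%N pi' i \in [seq deg v | v <- enum T'].
    by rewrite -(mem_sort geq) -/(degree_seq T') dT' mem_nth.
  exact: degr_gt0 nuv T'c x.
rewrite -dT in maj.
have [h [[hs hi hc _] dh wh]] := majorized_improves fsym fgood Tt ss' pos' maj.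
(* The improved tree lives on the vertices of [T] and has degree sequence [pi'], so it competes with
   [T']. *)
pose H := SGraph hs hi.
have := T'max H (conj (conj T0 hc) dh); apply: lt_le_trans.
by rewrite -(ltr_pMn2r (n := 2)) // !Mf_weight.
Qed.
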